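(* Let $\alpha,a\in\mathbb{R}$. For every integer $\nu\ge 1$ and all $x\in\mathbb{R}$, $$\frac{dQ^{(\alpha,-a)}_{\nu}(x)}{dx}=-\nu(2a+\nu+1)\,Q^{(\alpha,-a)}_{\nu-1}(x).$$
   Context: Throughout $x$ is a real variable, $\alpha,a$ are real parameters, $\sigma(x)=1+x^2$, and $\cot^{-1}:\mathbb{R}\to(0,\pi)$ is the smooth branch, so that $\frac{d}{dx}\cot^{-1}x=-1/\sigma(x)$. For integers $l\ge 0$ put $w_l(x)=\sigma(x)^{-(l+a+1)}e^{-\alpha\cot^{-1}x}=\sigma(x)^{-l}w_0(x)$. Define $P_l^{(a,\alpha)}(x)=\frac{1}{w_l(x)}\frac{d^l}{dx^l}[w_l(x)\sigma(x)^l]=\frac{\sigma(x)^l}{w_0(x)}\frac{d^l w_0(x)}{dx^l}$. The complementary (Romanovski) polynomials $Q_\nu^{(\alpha,-a)}$, with $Q_0^{(\alpha,-a)}\equiv 1$, are defined by the Rodrigues representation $P_l^{(a,\alpha)}(x)=\frac{1}{w_l(x)}\frac{d^{l-\nu}}{dx^{l-\nu}}[\sigma(x)^{l-\nu}w_l(x)Q_\nu^{(\alpha,-a)}(x)]$ for all integers $0\le\nu\le l$ (the case $l=\nu$ reads $Q_\nu^{(\alpha,-a)}=P_\nu^{(a,\alpha)}$). The second upper index is minus the parameter $a$ of the weight. *)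

(* Defs.v *)
From Stdlib Require Import Reals Lra Lia.
From Coquelicot Require Import Coquelicot.
Open Scope R_scope.

Definition sigma (x : R) : R := 1 + x ^ 2.

(* The smooth branch of the inverse cotangent, with values in (0, PI). *)
Definition acot (x : R) : R := PI / 2 - atan x.

Definition weight (alpha a : R) (l : nat) (x : R) : R :=
  Rpower (sigma x) (- (INR l + a + 1)) * exp (- alpha * acot x).

Definition romanovski_P (alpha a : R) (l : nat) (x : R) : R :=
  / weight alpha a l x
  * Derive_n (fun y => weight alpha a l y * sigma y ^ l) l x.

(* [Q nu] stands for $Q_\nu^{(\alpha,-a)}$: here [a] is the parameter of the
   weight, so the second upper index of the family is [- a].  The case
   [l = nu] gives [Q nu x = romanovski_P alpha a nu x], so at most one family
   (up to pointwise equality) satisfies this predicate;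
   [complementary_polynomials_exist] shows that one does. *)
Definition complementary_polynomials
    (alpha a : R) (Q : nat -> R -> R) : Prop :=
  (forall x : R, Q 0%nat x = 1) /\
  (forall nu l : nat, (nu <= l)%nat -> forall x : R,
     romanovski_P alpha a l x =
     / weight alpha a l x
     * Derive_n (fun y => sigma y ^ (l - nu) * weight alpha a l y * Q nu y)
         (l - nu) x).

Lemma sigma_pos (x : R) : 0 < sigma x.
Proof. unfold sigma; nra. Qed.

Lemma weight_pos (alpha a : R) (l : nat) (x : R) : 0 < weight alpha a l x.
Proof.
unfold weight, Rpower; apply Rmult_lt_0_compat; apply exp_pos.
Qed.

Lemma weight_sigma (alpha a : R) (l : nat) (x : R) :
  weight alpha a l x * sigma x ^ l = weight alpha a 0 x.
Proof.
unfold weight.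
rewrite <- (Rpower_pow l _ (sigma_pos x)).
replace (- (INR 0 + a + 1)) with (- (INR l + a + 1) + INR l) by (simpl; ring).
rewrite Rpower_plus; ring.
Qed.

Lemma complementary_polynomials_exist (alpha a : R) :
  complementary_polynomials alpha a (romanovski_P alpha a).
Proof.
assert (HP : forall n l x,
    Derive_n (fun y => weight alpha a l y * sigma y ^ l) n x
    = Derive_n (weight alpha a 0) n x).
{ intros n l x; apply Derive_n_ext; intros y; apply weight_sigma. }
split.
- intros x; unfold romanovski_P; simpl.
  generalize (weight_pos alpha a 0 x); intros H; field; lra.
- intros nu l Hl x; unfold romanovski_P at 1; f_equal.
  rewrite HP.
  replace l with ((l - nu) + nu)%nat at 1 by lia.
  rewrite <- Derive_n_comp.
  apply Derive_n_ext; intros y; unfold romanovski_P.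
  rewrite HP.
  generalize (weight_pos alpha a nu y) (sigma_pos y); intros Hw Hs.
  assert (E : sigma y ^ (l - nu) * weight alpha a l y = weight alpha a nu y).
  { apply Rmult_eq_reg_r with (sigma y ^ nu).
    - rewrite (weight_sigma alpha a nu), <- (weight_sigma alpha a l).
      replace l with ((l - nu) + nu)%nat at 4 by lia.
      rewrite pow_add; ring.
    - apply pow_nonzero; lra. }
  rewrite E; field; lra.
Qed.

(* Main.v *)
From Stdlib Require Import Reals Lra.
From Coquelicot Require Import Coquelicot.
Require Import Defs.
Open Scope R_scope.

(** Taking [l = nu] in the Rodrigues formula gives
    [Q nu = sigma ^ nu * w^(nu) / w] with [w = weight alpha a 0], so only this
    one family has to be differentiated.  The weight solves the Pearson equation
    [sigma * w' = tau * w] with [tau = alpha - 2 (a + 1) x].  Differentiating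
    that equation [n] times by Leibniz, where [sigma] contributes only two
    further terms because it is quadratic, gives after multiplication by
    [sigma ^ n / w] the three-term recurrence
    [Q (n+1) = (tau - 2 n x) Q n - n (2 a + n + 1) sigma Q (n-1)].
    On the other hand, differentiating [w^(n) = w * Q n / sigma ^ n] once gives
    [Q (n+1) = (tau - 2 n x) Q n + sigma * (Q n)'].  Comparing the two formulas
    yields [(Q n)' = - n (2 a + n + 1) Q (n-1)].

    The formal argument runs this in the order that avoids the Leibniz rule: the
    polynomials are defined by the three-term recurrence ([romanovski_Q]), the
    recurrence alone implies the derivative formula by induction
    ([is_derive_romanovski_Q]), and the derivative formula turns the recurrence
    into the rule for differentiating [w * Q n / sigma ^ n], so that these are
    the derivatives of the weight ([Derive_n_weight]). *)

Definition tau (alpha a x : R) : R := alpha - 2 * (a + 1) * x.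

Definition derivative_factor (a : R) (n : nat) : R :=
  INR n * (2 * a + INR n + 1).

(** At [n = 0] the recurrence reads [pred 0 = 0], which is harmless:
    [derivative_factor a 0] vanishes, so the two steps [1], [tau] start the
    family as they should. *)
Fixpoint romanovski_Q (alpha a : R) (n : nat) (x : R) : R :=
  match n with
  | O => 1
  | S m => (tau alpha a x - 2 * INR m * x) * romanovski_Q alpha a m x
           - derivative_factor a m * sigma x * romanovski_Q alpha a (pred m) x
  end.

Lemma romanovski_QS (alpha a : R) (n : nat) (x : R) :
  romanovski_Q alpha a (S n) x
  = (tau alpha a x - 2 * INR n * x) * romanovski_Q alpha a n x
    - derivative_factor a n * sigma x * romanovski_Q alpha a (pred n) x.
Proof. reflexivity. Qed.

(** Differentiate the recurrence for [n + 1] and insert the formulas for [n] and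
    [n - 1]: the terms other than [-2 (a + 1 + n) Q n] regroup, by the
    recurrence for [n], into [- derivative_factor a n * Q n], and
    [derivative_factor a n + 2 (a + 1 + n) = derivative_factor a (n + 1)]. *)
Lemma is_derive_romanovski_Q (alpha a : R) (n : nat) (x : R) :
  is_derive (romanovski_Q alpha a n) x
    (- derivative_factor a n * romanovski_Q alpha a (pred n) x).
Proof.
(* The step uses the formula at [n] and at [pred n]. *)
enough (H : forall x,
    is_derive (romanovski_Q alpha a n) x
      (- derivative_factor a n * romanovski_Q alpha a (pred n) x) /\
    is_derive (romanovski_Q alpha a (pred n)) x
      (- derivative_factor a (pred n) * romanovski_Q alpha a (pred (pred n)) x))
  by apply H.
clear x; induction n as [|n IH]; intros x.
- assert (H0 : is_derive (romanovski_Q alpha a 0) x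
      (- derivative_factor a 0 * romanovski_Q alpha a 0 x)).
  { replace (- derivative_factor a 0 * romanovski_Q alpha a 0 x) with 0
      by (unfold derivative_factor; simpl; ring).
    exact (is_derive_const 1 x). }
  split; exact H0.
- destruct (IH x) as [Hn Hp]; split; [|exact Hn].
  apply is_derive_ext with (fun y =>
    (tau alpha a y - 2 * INR n * y) * romanovski_Q alpha a n y
    - derivative_factor a n * sigma y * romanovski_Q alpha a (pred n) y).
  { intros y; reflexivity. }
  unfold tau, sigma; auto_derive.
  { split; [eexists; exact Hn|split; [eexists; exact Hp|exact I]]. }
  rewrite (is_derive_unique (fun y : R => romanovski_Q alpha a n y) _ _ Hn).
  rewrite (is_derive_unique (fun y : R => romanovski_Q alpha a (pred n) y) _ _ Hp).
  destruct n as [|m].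
  + unfold derivative_factor; simpl; ring.
  + simpl pred; rewrite (romanovski_QS alpha a m x).
    unfold derivative_factor, tau, sigma; rewrite !S_INR; ring.
Qed.

(** The Pearson equation [sigma * w' = tau * w]. *)
Lemma is_derive_weight (alpha a x : R) :
  is_derive (weight alpha a 0) x
    (tau alpha a x / sigma x * weight alpha a 0 x).
Proof.
generalize (sigma_pos x); intros Hs.
unfold weight, acot, Rpower, tau; unfold sigma in *; auto_derive.
- simpl in *; lra.
- simpl; unfold Rdiv, Rminus; field; simpl in Hs; lra.
Qed.

(** One more differentiation of [w * Q n / sigma ^ n] gives
    [w * ((tau - 2 n x) Q n + sigma * (Q n)') / sigma ^ (n + 1)], whose numerator
    is [Q (n + 1)] by the derivative formula and the recurrence. *)
Lemma Derive_n_weight (alpha a : R) (n : nat) (x : R) :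
  Derive_n (weight alpha a 0) n x
  = weight alpha a 0 x * romanovski_Q alpha a n x / sigma x ^ n.
Proof.
revert x; induction n as [|n IH]; intros x.
- simpl; field.
- simpl Derive_n; rewrite (Derive_ext _ _ x IH).
  generalize (sigma_pos x); intros Hs.
  assert (Hpow : sigma x ^ n <> 0) by (apply pow_nonzero; lra).
  assert (Hsigma : is_derive (fun y => sigma y ^ n) x
      (2 * INR n * x * sigma x ^ n / sigma x)).
  { unfold sigma in *; auto_derive; [exact I|].
    destruct n as [|m].
    - simpl; field; simpl in Hs; lra.
    - simpl pred; rewrite <- tech_pow_Rmult.
      replace (x * (x * 1)) with (x ^ 2) by ring; field; lra. }
  apply is_derive_unique.
  evar_last.
  + apply is_derive_div; [|exact Hsigma|exact Hpow].
    apply (is_derive_mult (weight alpha a 0) (romanovski_Q alpha a n)).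
    * apply is_derive_weight.
    * apply is_derive_romanovski_Q.
    * intros; apply Rmult_comm.
  + rewrite romanovski_QS; unfold plus, mult; simpl.
    field; split; [exact Hpow|lra].
Qed.

Lemma romanovski_P_eq_Q (alpha a : R) (n : nat) (x : R) :
  romanovski_P alpha a n x = romanovski_Q alpha a n x.
Proof.
unfold romanovski_P.
rewrite (Derive_n_ext _ _ n x (weight_sigma alpha a n)), Derive_n_weight.
rewrite <- (weight_sigma alpha a n x).
generalize (weight_pos alpha a n x) (sigma_pos x); intros Hw Hs.
field; split; [apply pow_nonzero|]; lra.
Qed.

Lemma complementary_polynomials_unique (alpha a : R) (Q : nat -> R -> R) :
  complementary_polynomials alpha a Q ->
  forall n x, Q n x = romanovski_Q alpha a n x.
Proof.
intros [_ HQ] n x.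
rewrite <- romanovski_P_eq_Q, (HQ n n (le_n n) x), Nat.sub_diag; simpl.
generalize (weight_pos alpha a n x); intros Hw; field; lra.
Qed.

Theorem theorem1p2 :
  forall (alpha a : R) (Q : nat -> R -> R),
    complementary_polynomials alpha a Q ->
    forall nu : nat, (1 <= nu)%nat ->
    forall x : R,
      is_derive (Q nu) x
        (- INR nu * (2 * a + INR nu + 1) * Q (nu - 1)%nat x).
Proof.
intros alpha a Q HQ nu _ x.
assert (E := complementary_polynomials_unique alpha a Q HQ).
apply is_derive_ext with (romanovski_Q alpha a nu).
{ intros y; symmetry; apply E. }
evar_last.
- apply is_derive_romanovski_Q.
- rewrite E, Nat.sub_1_r; unfold derivative_factor; ring.
Qed.
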